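(* Let $\mathcal{C}=\{\mathbf{c}_1,\dots,\mathbf{c}_l\}\subseteq G=\mathbb{Z}^r$ be a nonempty finite set, and let $\mathbf{v}\in G$ be a coarsening vector for $S$ such that $\mathbf{v}\cdot\mathbf{c}_j\ge0$ for all $j=1,\dots,l$. Let $k\in\mathbb{Z}$, let $M$ be a $G$-graded $S$-module, let $\mathbf{m}\in G$, and let $B\subseteq S$ be a $G$-graded ideal. Let $i\ge0$ and suppose that $$H^i_B(M)_{\mathbf{d}}=0\quad\text{for all }\mathbf{d}\in G\text{ such that }\deg_{\mathbf{v}}(\mathbf{d})\ge\deg_{\mathbf{v}}(\mathbf{m})+(k-i)\cdot m(k,i),$$ where $m(k,i)=\max_{1\le j\le l}(\mathbf{v}\cdot\mathbf{c}_j)$ if $k-i<0$ and $m(k,i)=\min_{1\le j\le l}(\mathbf{v}\cdot\mathbf{c}_j)$ if $k-i\ge0$. Then $$\mathbf{m}+\mathbb{N}\mathcal{C}[k-i]\subseteq\mathcal{Z}^i_B(M).$$ In particular, if $k=1$ and the supposition holds for all $i\ge0$, then $\mathbf{m}\in\mathrm{reg}_{B,\mathcal{C}}(M)$.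
   Context: $K$ is a field, $G=\mathbb{Z}^r$, and $S=K[x_1,\dots,x_n]$ is a $G$-graded polynomial $K$-algebra. A vector $\mathbf{v}\in\mathbb{Z}^r$ is a coarsening vector for $S$ if $\mathbf{v}\cdot\deg(x_i)\ge0$ for all $i$. For $\mathbf{d}\in G$, $\deg_{\mathbf{v}}(\mathbf{d})=\mathbf{v}\cdot\mathbf{d}$. $\mathbb{N}=\mathbb{Z}_{\ge0}$; $\mathbb{N}\mathcal{C}$ is the sub-semigroup of $G$ (containing $\mathbf{0}$) generated by $\mathcal{C}$; for $j\in\mathbb{Z}$, $\mathbb{N}\mathcal{C}[j]=\bigcup_{\mathbf{w}\in\mathbb{N}^l,\ \sum w_i=|j|}(\mathrm{sign}(j)\sum_iw_i\mathbf{c}_i+\mathbb{N}\mathcal{C})$, with $\mathbb{N}\mathcal{C}[0]=\mathbb{N}\mathcal{C}$. $H^i_B(M)$ is the $G$-graded local cohomology; $\mathcal{Z}^i_B(M)=\{\mathbf{p}\in G:H^i_B(M)_{\mathbf{p}}=0\}$; and $\mathrm{reg}_{B,\mathcal{C}}(M)=\{\mathbf{m}\in G:\mathbf{m}+\mathbb{N}\mathcal{C}[1-i]\subseteq\mathcal{Z}^i_B(M)\ \text{for all }i\ge0\}$. *)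

(* Defs.v *)
From HB Require Import structures.
From mathcomp Require Import all_boot all_order all_algebra.
From mathcomp Require Import mpoly.
From mathcomp Require Import boolp classical_sets functions.

Set Implicit Arguments.
Unset Strict Implicit.
Unset Printing Implicit Defensive.

Import Order.TTheory GRing.Theory Num.Theory.

Local Open Scope ring_scope.

Section Graded.
Context {K : fieldType} {n r : nat} (deg : 'I_n -> 'rV[int]_r).
Local Notation S := {mpoly K[n]}.
Local Notation G := 'rV[int]_r.

Definition mondeg (u : 'X_{1..n}) : G := \sum_(i < n) deg i *+ u i.

(* S_g : the polynomials all of whose monomials have degree g, so that
   constants have degree 0. *)
Definition poly_piece (g : G) : {pred S} :=
  fun f => all (fun u => mondeg u == g) (msupp f).

(* [is_grading piece]: M is the direct sum of the subgroups [piece g], and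
   S_g M_h is contained in M_(g+h). *)
Definition is_grading (M : lmodType S) (piece : G -> {pred M}) : Prop :=
  [/\ forall g, zmod_closed (piece g),
      forall g h f x, f \in poly_piece g -> x \in piece h ->
        f *: x \in piece (g + h),
      forall x, exists2 t : seq M,
        (forall y, y \in t -> exists g, y \in piece g) & x = \sum_(y <- t) y
    & forall (s : seq G) (c : G -> M), uniq s ->
        (forall g, c g \in piece g) -> \sum_(g <- s) c g = 0 ->
        forall g, g \in s -> c g = 0].

Record graded_module := GradedModule {
  gm_sort :> lmodType S;
  gm_piece : G -> {pred gm_sort};
  gm_grading : is_grading gm_piece }.

Record graded_submodule (N : graded_module) := GradedSubmodule {
  gs_pred :> {pred N};
  gs_closed : submod_closed gs_pred;
  gs_graded : forall x, x \in gs_pred -> exists2 t : seq N,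
    (forall y, y \in t -> y \in gs_pred /\ exists g, y \in gm_piece g)
    & x = \sum_(y <- t) y }.

(* Degree-preserving S-linear maps, the morphisms of the category of G-graded
   S-modules. *)
Record graded_hom (M N : graded_module) := GradedHom {
  gh_fun :> {linear M -> N};
  gh_piece : forall g x, x \in gm_piece g -> gh_fun x \in gm_piece g }.

HB.instance Definition _ (N : graded_module) (P : graded_submodule N) :=
  GRing.isSubmodClosed.Build S N (gs_pred P) (gs_closed P).

Section Components.
Variable N : graded_module.

Lemma pieceB g (x y : N) :
  x \in gm_piece g -> y \in gm_piece g -> x - y \in gm_piece g.
Proof. by case: (gm_grading N) => /(_ g) [_ h] _ _ _; apply: h. Qed.
Lemma piece0 g : (0 : N) \in gm_piece g.
Proof. by case: (gm_grading N) => /(_ g) []. Qed.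
Lemma pieceN g (x : N) : x \in gm_piece g -> - x \in gm_piece g.
Proof. by move=> h; rewrite -sub0r pieceB ?piece0. Qed.
Lemma pieceD g (x y : N) :
  x \in gm_piece g -> y \in gm_piece g -> x + y \in gm_piece g.
Proof. by move=> hx hy; rewrite -[y]opprK pieceB ?pieceN. Qed.
Lemma pieceZ g h f (x : N) :
  f \in poly_piece g -> x \in gm_piece h -> f *: x \in gm_piece (g + h).
Proof. by case: (gm_grading N) => _ h2 _ _; apply: h2. Qed.
Lemma piece_gen (x : N) : exists2 t : seq N,
  (forall y, y \in t -> exists g, y \in gm_piece g) & x = \sum_(y <- t) y.
Proof. by case: (gm_grading N). Qed.
Lemma piece_ind (s : seq G) (c : G -> N) : uniq s ->
  (forall g, c g \in gm_piece g) -> \sum_(g <- s) c g = 0 ->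
  forall g, g \in s -> c g = 0.
Proof. by case: (gm_grading N) => _ _ _; apply. Qed.

Definition comps_spec (x : N) (c : G -> N) :=
  exists s : seq G, [/\ uniq s, forall g, c g \in gm_piece g,
    forall g, g \notin s -> c g = 0 & x = \sum_(g <- s) c g].

Lemma sum_supp (s s' : seq G) (c : G -> N) : uniq s -> uniq s' ->
  {subset s <= s'} -> (forall g, g \notin s -> c g = 0) ->
  \sum_(g <- s) c g = \sum_(g <- s') c g.
Proof.
move=> us us' sub c0; rewrite [RHS](bigID (mem s)) /= [X in _ + X]big1 ?addr0;
  last by move=> g; apply: c0.
rewrite -[RHS]big_filter; apply: perm_big; apply: uniq_perm => //.
  exact: filter_uniq.
by move=> g; rewrite mem_filter; case: (boolP (g \in s)) => //= /sub ->.
Qed.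

Lemma comps_specB x y c e : comps_spec x c -> comps_spec y e ->
  comps_spec (x - y) (fun g => c g - e g).
Proof.
move=> [s [us cp c0 ->]] [s' [us' ep e0 ->]].
exists (undup (s ++ s')); split; first exact: undup_uniq.
- by move=> g; apply: pieceB.
- move=> g; rewrite mem_undup mem_cat negb_or => /andP[h1 h2].
  by rewrite c0 // e0 // subr0.
rewrite sumrB; congr (_ - _); apply: sum_supp => //; try exact: undup_uniq.
  by move=> g h; rewrite mem_undup mem_cat h.
by move=> g h; rewrite mem_undup mem_cat h orbT.
Qed.

Lemma comps_spec_eq0 c : comps_spec 0 c -> forall g, c g = 0.
Proof.
move=> [s [us cp c0 /esym h]] g; case: (boolP (g \in s)); last exact: c0.
exact: piece_ind us cp h g.
Qed.

Lemma comps_spec_uniq x c e : comps_spec x c -> comps_spec x e ->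
  forall g, c g = e g.
Proof.
move=> h h' g; apply/eqP; rewrite -subr_eq0; apply/eqP.
have := comps_specB h h'; rewrite subrr => /comps_spec_eq0; apply.
Qed.

Lemma comps_spec1 g x : x \in gm_piece g ->
  comps_spec x (fun h => if h == g then x else 0).
Proof.
move=> hx; exists [:: g]; split=> //.
- by move=> h; case: eqP => [->|_] //; apply: piece0.
- by move=> h; rewrite inE => /negPf ->.
by rewrite big_seq1 eqxx.
Qed.

Lemma comps_spec0 : comps_spec 0 (fun=> 0).
Proof.
by exists [::]; split=> //; [move=> g; apply: piece0 | rewrite big_nil].
Qed.

Lemma comps_specN x c : comps_spec x c -> comps_spec (- x) (fun g => - c g).
Proof.
move=> h; have := comps_specB comps_spec0 h; rewrite sub0r.
by congr comps_spec; apply: funext => g; rewrite sub0r.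
Qed.

Lemma comps_specD x y c e : comps_spec x c -> comps_spec y e ->
  comps_spec (x + y) (fun g => c g + e g).
Proof.
move=> h /comps_specN h'; have := comps_specB h h'; rewrite opprK.
by congr comps_spec; apply: funext => g; rewrite opprK.
Qed.

Lemma comps_ex x : exists c, comps_spec x c.
Proof.
have [t ht ->] := piece_gen x; elim: t ht => [|y t IH] ht.
  by rewrite big_nil; exists (fun=> 0); apply: comps_spec0.
have [c hc] : exists c, comps_spec (\sum_(y <- t) y) c.
  by apply: IH => z hz; apply: ht; rewrite inE hz orbT.
have [|g hg] := ht y; first by rewrite inE eqxx.
by rewrite big_cons; eexists; apply: comps_specD (comps_spec1 hg) hc.
Qed.

Definition comps x : G -> N := projT1 (cid (comps_ex x)).
Lemma compsP x : comps_spec x (comps x).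
Proof. exact: projT2 (cid (comps_ex x)). Qed.
Lemma comps_eq x c : comps_spec x c -> comps x = c.
Proof.
by move=> h; apply: funext => g; apply: comps_spec_uniq (compsP x) h g.
Qed.
Lemma comps_piece x g : comps x g \in gm_piece g.
Proof. by have [s []] := compsP x. Qed.
Lemma compsD x y g : comps (x + y) g = comps x g + comps y g.
Proof. by rewrite (comps_eq (comps_specD (compsP x) (compsP y))). Qed.
Lemma comps0 g : comps 0 g = 0.
Proof. by rewrite (comps_eq comps_spec0). Qed.
Lemma comps_hom g x : x \in gm_piece g -> comps x g = x.
Proof. by move=> /comps_spec1/comps_eq ->; rewrite eqxx. Qed.
Lemma comps_hom0 g h x : x \in gm_piece g -> h != g -> comps x h = 0.
Proof. by move=> /comps_spec1/comps_eq -> /negPf ->. Qed.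
Lemma comps_seq x : exists2 t : seq N,
  (forall y, y \in t -> exists g, y = comps x g) & x = \sum_(y <- t) y.
Proof.
have [s [_ _ _ h]] := compsP x.
exists [seq comps x g | g <- s].
  by move=> y /mapP [g _ ->]; exists g.
by rewrite big_map.
Qed.

Lemma compsZ f g x h : f \in poly_piece g ->
  comps (f *: x) (g + h) = f *: comps x h.
Proof.
move=> hf; have [t ht ->] := piece_gen x; elim: t ht => [|y t IH] ht.
  by rewrite big_nil scaler0 !comps0 scaler0.
rewrite big_cons scalerDr !compsD scalerDr IH; last first.
  by move=> z hz; apply: ht; rewrite inE hz orbT.
congr (_ + _); have [|k hk] := ht y; first by rewrite inE eqxx.
have [->|hn] := eqVneq h k; first by rewrite !comps_hom ?pieceZ.
rewrite (comps_hom0 hk hn) scaler0.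
by rewrite (comps_hom0 (pieceZ hf hk)) // (inj_eq (addrI g)).
Qed.
End Components.

Lemma sub_comps (N : graded_module) (P : graded_submodule N) x :
  x \in P -> forall g, comps x g \in P.
Proof.
move=> /gs_graded [t ht ->] g; elim: t ht => [|y t IH] ht.
  by rewrite big_nil comps0 rpred0.
rewrite big_cons compsD rpredD ?IH //; last first.
  by move=> z hz; apply: ht; rewrite inE hz orbT.
have [|yP [k hk]] := ht y; first by rewrite inE eqxx.
have [->|hn] := eqVneq g k; first by rewrite comps_hom.
by rewrite (comps_hom0 hk hn) rpred0.
Qed.

Lemma comps_graded (N : graded_module) (P : {pred N}) :
  (forall x g, x \in P -> comps x g \in P) ->
  forall x, x \in P -> exists2 t : seq N,
    (forall y, y \in t -> y \in P /\ exists g, y \in gm_piece g)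
    & x = \sum_(y <- t) y.
Proof.
move=> hP x xP; have [t ht hx] := comps_seq x; exists t => // y /ht [g ->].
by split; [apply: hP | exists g; apply: comps_piece].
Qed.

Lemma hom_comps (M N : graded_module) (f : graded_hom M N) x g :
  f (comps x g) = comps (f x) g.
Proof.
have [t ht ->] := piece_gen x; elim: t ht => [|y t IH] ht.
  by rewrite big_nil linear0 !comps0 linear0.
rewrite big_cons linearD !compsD linearD IH; last first.
  by move=> z hz; apply: ht; rewrite inE hz orbT.
congr (_ + _); have [|k hk] := ht y; first by rewrite inE eqxx.
have [->|hn] := eqVneq g k; first by rewrite !comps_hom ?gh_piece.
by rewrite !(@comps_hom0 _ k) ?gh_piece ?linear0.
Qed.

Lemma poly_piece1 : 1 \in poly_piece 0.
Proof.
by rewrite /poly_piece unfold_in msupp1 /= andbT /mondeg big1 // => i _;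
  rewrite mnm0E.
Qed.

Lemma mondegD u v : mondeg (u + v)%MM = mondeg u + mondeg v.
Proof.
by rewrite /mondeg -big_split; apply: eq_bigr => i _; rewrite mnmDE mulrnDr.
Qed.

Lemma poly_pieceE g f :
  reflect (forall u, u \in msupp f -> mondeg u = g) (f \in poly_piece g).
Proof.
by apply: (iffP allP) => h u /h /eqP.
Qed.

Lemma regular_grading :
  @is_grading (S^o : lmodType S) (fun g => poly_piece g : {pred S^o}).
Proof.
split.
- move=> g; split; first by apply/poly_pieceE => u; rewrite msupp0.
  move=> x y /poly_pieceE hx /poly_pieceE hy; apply/poly_pieceE => u /msuppB_le.
  by rewrite mem_cat => /orP [/hx|/hy].
- move=> g h f x /poly_pieceE hf /poly_pieceE hx; apply/poly_pieceE => u.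
  move=> /msuppM_le /allpairsP [[a b] /= [/hf ha /hx hb ->]].
  by rewrite mondegD ha hb.
- move=> f; exists [seq f@_u *: 'X_[u] | u <- msupp f].
    move=> y /mapP [u hu ->]; exists (mondeg u); apply/poly_pieceE => v.
    by rewrite msuppMCX -?mcoeff_msupp // inE => /eqP ->.
  by rewrite big_map -mpolyE.
move=> s c us hc h g gs; apply/mpolyP => u; rewrite mcoeff0.
have [hu|hu] := eqVneq (mondeg u) g; last first.
  apply: memN_msupp_eq0; apply: contra hu => hu; apply/eqP.
  by move/poly_pieceE: (hc g); apply.
have /(congr1 (mcoeff u)) := h; rewrite mcoeff0 raddf_sum /= (bigD1_seq g) //=.
rewrite big1 ?addr0 // => k kg; apply: memN_msupp_eq0.
by apply: contra kg => hk; move/poly_pieceE: (hc k) => /(_ _ hk) <-; rewrite hu.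
Qed.

Definition regular : graded_module := GradedModule regular_grading.


(* Injective objects of the category of G-graded S-modules. *)
Definition gr_injective (J : graded_module) : Prop :=
  forall (A B : graded_module) (f : graded_hom A B) (g : graded_hom A J),
    injective f -> exists h : graded_hom B J, forall a, h (f a) = g a.

Record injective_resolution (M : graded_module) := InjectiveResolution {
  ir_obj :> nat -> graded_module;
  ir_aug : graded_hom M (ir_obj 0);
  ir_d : forall j, graded_hom (ir_obj j) (ir_obj j.+1);
  ir_injective : forall j, gr_injective (ir_obj j);
  ir_aug_inj : injective ir_aug;
  ir_exact0 : forall x, ir_d 0 x = 0 <-> exists y, x = ir_aug y;
  ir_exact : forall j x, ir_d j.+1 x = 0 <-> exists y, x = ir_d j y }.

Section Complement.
Variables (N : graded_module) (P : graded_submodule N).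

(* Graded K-subspaces of [N] meeting [P] trivially. *)
Definition kscale (a : K) (x : N) : N := a%:MP_[n] *: x.

Record complementary (W : set N) : Prop := Complementary {
  cm0 : W 0;
  cmD : forall x y, W x -> W y -> W (x + y);
  cmZ : forall a x, W x -> W (kscale a x);
  cmG : forall x g, W x -> W (comps x g);
  cmP : forall x, W x -> x \in P -> x = 0 }.

Lemma polyC_piece (a : K) : a%:MP_[n] \in poly_piece 0.
Proof.
apply/poly_pieceE => u; rewrite msuppC; case: eqP => // _; rewrite inE => /eqP ->.
by rewrite /mondeg big1 // => i _; rewrite mnm0E.
Qed.

Lemma comps_kscale a (x : N) g : comps (kscale a x) g = kscale a (comps x g).
Proof. by rewrite -[g in LHS]add0r compsZ ?polyC_piece. Qed.

Lemma kscaleD a (x y : N) : kscale a (x + y) = kscale a x + kscale a y.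
Proof. exact: scalerDr. Qed.
Lemma kscaleDl a b (x : N) : kscale (a + b) x = kscale a x + kscale b x.
Proof. by rewrite /kscale mpolyCD scalerDl. Qed.
Lemma kscaleA a b (x : N) : kscale a (kscale b x) = kscale (a * b) x.
Proof. by rewrite /kscale mpolyCM scalerA. Qed.
Lemma kscale1 (x : N) : kscale 1 x = x.
Proof. by rewrite /kscale mpolyC1 scale1r. Qed.
Lemma kscale0 (x : N) : kscale 0 x = 0.
Proof. by rewrite /kscale mpolyC0 scale0r. Qed.
Lemma kscaler0 a : kscale a 0 = 0.
Proof. exact: scaler0. Qed.
Lemma kscaleN a (x : N) : kscale a (- x) = - kscale a x.
Proof. exact: scalerN. Qed.
Lemma kscaleN1 (x : N) : kscale (-1) x = - x.
Proof. by rewrite /kscale mpolyCN mpolyC1 scaleN1r. Qed.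

Lemma P_kscale a x : x \in P -> kscale a x \in P.
Proof. exact: rpredZ. Qed.

Lemma complement_ex : exists2 W : set N, complementary W &
  forall x, exists2 w, W w & x - w \in P.
Proof.
pose T := {W : set N | complementary W}.
pose R (U V : T) := `[< (projT1 U `<=` projT1 V)%classic >].
have T0 : complementary [set x : N | x = 0]%classic.
  split=> //=.
  - by move=> x y -> ->; rewrite addr0.
  - by move=> a x ->; rewrite kscaler0.
  - by move=> x g ->; rewrite comps0.
have [||||[W hW] Wmax] := @Zorn T R.
- by move=> U; apply/asboolP.
- by move=> A B C /asboolP h1 /asboolP h2; apply/asboolP; apply: subset_trans h2.
- move=> [U hU] [V hV] /asboolP h1 /asboolP h2.
  have e : U = V by apply/seteqP; split.
  by subst V; rewrite (Prop_irrelevance hU hV).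
- move=> A tot.
  have [[U0 AU0]|Ae] := pselect (exists U, A U); last first.
    by exists (exist _ _ T0) => U AU; case: Ae; exists U.
  have hU : complementary [set x : N | exists2 U, A U & projT1 U x]%classic.
    split=> /=.
    - by exists U0 => //; apply: (cm0 (projT2 U0)).
    - move=> x y [U AU Ux] [V AV Vy].
      have [/asboolP h|/asboolP h] := tot U V AU AV.
        by exists V => //; apply: (cmD (projT2 V)) => //; apply: h.
      by exists U => //; apply: (cmD (projT2 U)) => //; apply: h.
    - by move=> a x [U AU Ux]; exists U => //; apply: (cmZ (projT2 U)).
    - by move=> x g [U AU Ux]; exists U => //; apply: (cmG (projT2 U)).
    - by move=> x [U AU Ux]; apply: (cmP (projT2 U)).
  by exists (exist _ _ hU) => U AU; apply/asboolP => x Ux; exists U.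
exists W => //.
suff hom : forall g x, x \in gm_piece g -> exists2 w, W w & x - w \in P.
  move=> x; have [t ht ->] := piece_gen x; elim: t ht => [|y t IH] ht.
    by exists 0; [apply: (cm0 hW) | rewrite big_nil subr0 rpred0].
  have [|g hg] := ht y; first by rewrite inE eqxx.
  have [w Ww wP] := hom g y hg.
  have [|v Wv vP] := IH; first by move=> z hz; apply: ht; rewrite inE hz orbT.
  exists (w + v); first exact: (cmD hW).
  by rewrite big_cons opprD addrACA rpredD.
move=> g x xg.
have [//|nx] := pselect (exists2 w, W w & x - w \in P).
pose V := [set y : N | exists w, exists2 a, W w & y = w + kscale a x]%classic.
have WN y : W y -> W (- y) by move=> h; rewrite -kscaleN1; apply: (cmZ hW).
have hV : complementary V.
  split.
  - by exists 0, 0; [exact: (cm0 hW) | rewrite kscale0 addr0].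
  - move=> _ _ [w [a Ww ->]] [v [b Wv ->]]; exists (w + v), (a + b).
      exact: (cmD hW).
    by rewrite kscaleDl addrACA.
  - move=> b _ [w [a Ww ->]]; exists (kscale b w), (b * a).
      exact: (cmZ hW).
    by rewrite kscaleD kscaleA.
  - move=> _ h [w [a Ww ->]]; exists (comps w h), (if h == g then a else 0).
      exact: (cmG hW).
    rewrite compsD comps_kscale; have [->|hn] := eqVneq h g.
      by rewrite (comps_hom xg).
    by rewrite (comps_hom0 xg hn) kscaler0 kscale0.
  - move=> _ [w [a Ww ->]] hP; have [a0|an0] := eqVneq a 0.
      by move: hP; rewrite a0 kscale0 addr0; apply: (cmP hW).
    case: nx; exists (- kscale a^-1 w); first by apply: WN; apply: (cmZ hW).
    have -> : x - - kscale a^-1 w = kscale a^-1 (w + kscale a x).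
      by rewrite opprK kscaleD kscaleA mulVf // kscale1 addrC.
    exact: P_kscale.
have WV : R (exist _ W hW) (exist _ V hV).
  by apply/asboolP => y Wy; exists y, 0 => //; rewrite kscale0 addr0.
have /(congr1 (fun U : T => projT1 U)) /= e := Wmax _ WV.
exists x; last by rewrite subrr rpred0.
rewrite -e; exists 0, 1; first exact: (cm0 hW).
by rewrite kscale1 add0r.
Qed.

(* A graded K-linear endomorphism of [N] with kernel [P] whose image meets
   [P] trivially. *)
Lemma coproj_ex : exists p : N -> N,
  [/\ forall x y, p (x + y) = p x + p y, forall a x, p (kscale a x) = kscale a (p x),
      forall g x, x \in gm_piece g -> p x \in gm_piece g,
      forall x, p x = 0 <-> x \in P & forall x, x - p x \in P].
Proof.
have [W hW dec] := complement_ex.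
have ex x : exists w, W w /\ x - w \in P by have [w] := dec x; exists w.
pose p x := projT1 (cid (ex x)).
have pW x : W (p x) by have [] := projT2 (cid (ex x)).
have pP x : x - p x \in P by have [] := projT2 (cid (ex x)).
have WN y : W y -> W (- y) by move=> h; rewrite -kscaleN1; apply: (cmZ hW).
have pE x w : W w -> x - w \in P -> p x = w.
  move=> Ww hw; apply/eqP; rewrite -subr_eq0; apply/eqP; apply: (cmP hW).
    by apply: (cmD hW) => //; apply: WN.
  have -> : p x - w = (x - w) - (x - p x).
    by rewrite opprB [RHS]addrC addrA subrK.
  exact: rpredB.
exists p; split=> //.
- move=> x y; apply: pE; first exact: (cmD hW).
  by rewrite opprD addrACA rpredD.
- move=> a x; apply: pE; first exact: (cmZ hW).
  by rewrite -kscaleN -kscaleD P_kscale.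
- move=> g x xg; have -> : p x = comps (p x) g; last exact: comps_piece.
  apply: pE; first exact: (cmG hW).
  have := sub_comps (pP x) g; rewrite -[- p x]kscaleN1 compsD comps_kscale.
  by rewrite kscaleN1 comps_hom.
- move=> x; split=> [h|xP]; first by have := pP x; rewrite h subr0.
  by apply: pE; [apply: (cm0 hW) | rewrite subr0].
Qed.
End Complement.

(* The module *Hom_K(S, N) spanned by the homogeneous K-linear maps S -> N, on
   which S acts by (f phi)(g) = phi(g f). It is injective because K-linear maps
   extend along inclusions; every N embeds in it by x |-> (f |-> f x). *)
Section Coinduced.
Variable N : graded_module.

Definition k_linear (phi : S -> N) : Prop :=
  (forall f g, phi (f + g) = phi f + phi g) /\
  (forall a f, phi (a%:MP_[n] * f) = kscale a (phi f)).

Definition coind_piece (p : G) (phi : S -> N) : Prop :=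
  k_linear phi /\
  forall q f, f \in poly_piece q -> phi f \in gm_piece (p + q).

Definition coind_pred : {pred S -> N} := fun phi =>
  `[< exists2 t : seq (S -> N),
        (forall psi, psi \in t -> exists p, coind_piece p psi)
        & phi = \sum_(psi <- t) psi >].

Lemma coind_piece0 p : coind_piece p 0.
Proof.
split; last by move=> q f _; apply: piece0.
by split=> *; rewrite ?addr0 ?kscaler0.
Qed.

Lemma coind_pieceB p phi psi :
  coind_piece p phi -> coind_piece p psi -> coind_piece p (phi - psi).
Proof.
move=> [[aD aZ] aG] [[bD bZ] bG]; split; last first.
  by move=> q f hf; apply: pieceB; [apply: aG|apply: bG].
split=> [f g|a f].
  by rewrite !fctE aD bD opprD addrACA.
by rewrite !fctE aZ bZ -kscaleN -kscaleD.
Qed.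

Lemma coind_zmod : zmod_closed coind_pred.
Proof.
split; first by apply/asboolP; exists [::] => //; rewrite big_nil.
move=> phi psi /asboolP [t ht ->] /asboolP [u hu ->]; apply/asboolP.
exists (t ++ [seq - x | x <- u]); last by rewrite big_cat big_map sumrN.
move=> x; rewrite mem_cat => /orP [/ht //|/mapP [y /hu [p hp] ->]].
by exists p; rewrite -sub0r; apply: coind_pieceB => //; apply: coind_piece0.
Qed.
HB.instance Definition _ := GRing.isZmodClosed.Build (S -> N) coind_pred coind_zmod.

Record coind := Coind { coind_val : S -> N; _ : coind_pred coind_val }.
HB.instance Definition _ := [isSub for coind_val].
HB.instance Definition _ := [Choice of coind by <:].
HB.instance Definition _ := [SubChoice_isSubZmodule of coind by <:].

Definition shift (f : S) (phi : S -> N) : S -> N := fun g => phi (g * f).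

Lemma shift_piece q f p phi : f \in poly_piece q -> coind_piece p phi ->
  coind_piece (q + p) (shift f phi).
Proof.
move=> hf [[aD aZ] aG]; split; last first.
  move=> h g hg; rewrite [q + p]addrC -addrA; apply: aG; rewrite [q + h]addrC.
  by case: (regular_grading) => _ /(_ _ _ _ _ hg hf).
split=> [g h|a g]; first by rewrite /shift mulrDl aD.
by rewrite /shift -mulrA aZ.
Qed.

Lemma coind_klin phi : phi \in coind_pred -> k_linear phi.
Proof.
move=> /asboolP [t ht ->]; elim: t ht => [|psi t IH] ht.
  by rewrite big_nil; case: (coind_piece0 0).
have [|p [[aD aZ] _]] := ht psi; first by rewrite inE eqxx.
have [|bD bZ] := IH; first by move=> z hz; apply: ht; rewrite inE hz orbT.
rewrite big_cons; split=> [f g|a f]; rewrite !fctE ?aD ?aZ ?bD ?bZ.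
  by rewrite addrACA.
by rewrite kscaleD.
Qed.

Lemma coind_pred_piece p phi : coind_piece p phi -> phi \in coind_pred.
Proof.
move=> h; apply/asboolP; exists [:: phi]; last by rewrite big_seq1.
by move=> psi; rewrite inE => /eqP ->; exists p.
Qed.

Lemma shift_coind f phi : phi \in coind_pred -> shift f phi \in coind_pred.
Proof.
move=> hphi; have [t ht ->] := @piece_gen regular f.
have e : shift (\sum_(y <- t) y) phi = \sum_(y <- t) shift y phi.
  elim: t {ht} => [|y t IH].
    rewrite !big_nil; apply: funext => g; rewrite /shift mulr0.
    have [_ z] := coind_klin hphi.
    by have := z 0 0; rewrite mulr0 kscale0.
  rewrite !big_cons -IH; apply: funext => g; rewrite fctE /shift mulrDr.
  by have [-> _] := coind_klin hphi.
rewrite {}e; elim: t ht => [|y t IH] ht.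
  by rewrite big_nil rpred0.
rewrite big_cons rpredD ?IH //; last first.
  by move=> z hz; apply: ht; rewrite inE hz orbT.
have [|q yq] := ht y; first by rewrite inE eqxx.
move/asboolP: hphi => [u hu ->]; elim: u hu => [|psi u IHu] hu.
  rewrite big_nil; have -> : shift y (0 : S -> N) = 0 by apply: funext.
  exact: rpred0.
rewrite big_cons; have -> : shift y (psi + \sum_(j <- u) j) =
  shift y psi + shift y (\sum_(j <- u) j) by apply: funext.
rewrite rpredD ?IHu //; last by move=> z hz; apply: hu; rewrite inE hz orbT.
have [|p hp] := hu psi; first by rewrite inE eqxx.
exact: coind_pred_piece (shift_piece yq hp).
Qed.

Definition coind_scale (f : S) (phi : coind) : coind :=
  Sub (shift f (val phi)) (shift_coind f (valP phi)).

Lemma coind_scaleA a b v : coind_scale a (coind_scale b v) = coind_scale (a * b) v.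
Proof.
by apply: val_inj; apply: funext => g; rewrite /= /shift -mulrA.
Qed.
Lemma coind_scale1 : left_id 1 coind_scale.
Proof. by move=> v; apply: val_inj; apply: funext => g; rewrite /= /shift mulr1. Qed.
Lemma coind_scaleDr : right_distributive coind_scale +%R.
Proof. by move=> f x y; apply: val_inj; apply: funext => g. Qed.
Lemma coind_scaleDl v : {morph coind_scale^~ v : a b / a + b}.
Proof.
move=> f g; apply: val_inj; apply: funext => h; rewrite /= fctE /shift mulrDr.
by have [-> _] := coind_klin (valP v).
Qed.
HB.instance Definition _ := GRing.Zmodule_isLmodule.Build S coind
  coind_scaleA coind_scale1 coind_scaleDr coind_scaleDl.

Definition coind_gpiece (p : G) : {pred coind} :=
  fun phi => `[< coind_piece p (val phi) >].

Lemma val_coind_sum (I : Type) (s : seq I) (c : I -> coind) :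
  val (\sum_(i <- s) c i) = \sum_(i <- s) val (c i).
Proof. exact: (raddf_sum val). Qed.

Lemma fct_sumE (I : Type) (s : seq I) (c : I -> S -> N) f :
  (\sum_(i <- s) c i) f = \sum_(i <- s) c i f.
Proof. by elim/big_rec2: _ => // i x y _ <-. Qed.

Lemma coind_grading : is_grading coind_gpiece.
Proof.
split.
- move=> p; split; first by apply/asboolP; apply: coind_piece0.
  by move=> x y /asboolP hx /asboolP hy; apply/asboolP; apply: coind_pieceB.
- move=> g h f x hf /asboolP hx; apply/asboolP; exact: shift_piece.
- move=> [phi hphi]; have /asboolP [t ht e] := hphi.
  have tP psi : psi \in t -> psi \in coind_pred.
    by move=> /ht [p]; apply: coind_pred_piece.
  exists (pmap insub t).
    move=> y; rewrite mem_pmap_sub => /ht [p hp]; exists p; exact/asboolP.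
  apply: val_inj; rewrite /= val_coind_sum -(big_map val xpredT idfun) /=.
  rewrite e (_ : map _ _ = t) //; rewrite -[RHS]map_id.
  elim: t tP {ht e} => //= psi t IH tP.
  rewrite insubT /=; first by apply: tP; rewrite inE eqxx.
  move=> _ /=; rewrite IH // => z hz; apply: tP; by rewrite inE hz orbT.
move=> s c us hc h g gs; apply: val_inj; apply: funext => f /=.
have hom q f' : f' \in poly_piece q -> val (c g) f' = 0.
  move=> hf.
  have /(congr1 (fun z => val z f')) := h; rewrite val_coind_sum fct_sumE /= => e.
  pose e' k := val (c (k - q)) f'.
  have := @piece_ind N [seq k + q | k <- s] e'; rewrite map_inj_uniq; last exact: addIr.
  move=> /(_ us) H; have := H _ _ (g + q); rewrite /e' addrK; apply.
  - move=> k; have /asboolP [_ /(_ _ _ hf)] := hc (k - q).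
    by rewrite subrK.
  - by rewrite big_map -[RHS]e; apply: eq_bigr => k _; rewrite addrK.
  - by apply/mapP; exists g.
have [aD aZ] := coind_klin (valP (c g)).
have [t ht ->] := @piece_gen regular f; elim: t ht => [|y t IH] ht.
  by rewrite big_nil; have := aZ 0 0; rewrite mulr0 kscale0.
have [|q yq] := ht y; first by rewrite inE eqxx.
have h2 : val (c g) (\sum_(j <- t) j) = 0.
  by apply: IH => z hz; apply: ht; rewrite inE hz orbT.
by rewrite big_cons; apply: (etrans (aD _ _)); rewrite [X in _ + X]h2 addr0;
  apply: hom yq.
Qed.

Definition coinduced : graded_module := GradedModule coind_grading.

End Coinduced.

Definition zero_pred (N : graded_module) : {pred N} := pred1 0.
Lemma zero_closed N : submod_closed (@zero_pred N).
Proof.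
split; first by rewrite !inE.
by move=> a x y /eqP -> /eqP ->; rewrite scaler0 addr0 !inE.
Qed.
Lemma zero_graded N x : x \in @zero_pred N -> exists2 t : seq N,
    (forall y, y \in t -> y \in @zero_pred N /\ exists g, y \in gm_piece g)
    & x = \sum_(y <- t) y.
Proof. by move=> /eqP ->; exists [::] => //; rewrite big_nil. Qed.
Definition zero_sub N : graded_submodule N :=
  GradedSubmodule (zero_closed N) (@zero_graded N).

Lemma ker_closed M N (f : graded_hom M N) : submod_closed [pred x | f x == 0].
Proof.
split; first by rewrite inE linear0.
by move=> a x y; rewrite !inE linearP => /eqP -> /eqP ->; rewrite scaler0 addr0.
Qed.
Lemma ker_graded M N (f : graded_hom M N) x : x \in [pred x | f x == 0] ->
  exists2 t : seq M, (forall y, y \in t -> y \in [pred x | f x == 0] /\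
    exists g, y \in gm_piece g) & x = \sum_(y <- t) y.
Proof.
apply: comps_graded => {}x g; rewrite !inE hom_comps => /eqP ->.
by rewrite comps0.
Qed.
Definition ker_sub M N (f : graded_hom M N) : graded_submodule M :=
  GradedSubmodule (ker_closed f) (@ker_graded M N f).

Section Image.
Variables (M N : graded_module) (f : graded_hom M N) (P : graded_submodule M).
Definition image_pred : {pred N} :=
  fun x => `[< exists2 y, y \in P & x = f y >].
Lemma image_closed : submod_closed image_pred.
Proof.
split; first by apply/asboolP; exists 0; rewrite ?rpred0 ?linear0.
move=> a x y /asboolP [u uP ->] /asboolP [v vP ->]; apply/asboolP.
by exists (a *: u + v); rewrite ?linearP // rpredD ?rpredZ.
Qed.
Lemma image_graded x : x \in image_pred -> exists2 t : seq N,
  (forall y, y \in t -> y \in image_pred /\ exists g, y \in gm_piece g)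
  & x = \sum_(y <- t) y.
Proof.
apply: comps_graded => {}x g /asboolP [y yP ->]; apply/asboolP.
by exists (comps y g); [apply: sub_comps | rewrite hom_comps].
Qed.
Definition image_sub := GradedSubmodule image_closed image_graded.
End Image.

Lemma full_closed (N : graded_module) : submod_closed (predT : {pred N}).
Proof. by []. Qed.
Lemma full_graded (N : graded_module) x : x \in (predT : {pred N}) ->
  exists2 t : seq N, (forall y, y \in t -> y \in (predT : {pred N}) /\
    exists g, y \in gm_piece g) & x = \sum_(y <- t) y.
Proof. exact: comps_graded. Qed.
Definition full_sub N : graded_submodule N :=
  GradedSubmodule (full_closed N) (@full_graded N).

Lemma coinduced_injective N : gr_injective (coinduced N).
Proof.
move=> A B f g finj.
have [p [pD pZ pG pK pI]] := coproj_ex (image_sub f (full_sub A)).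
have ex b : exists a, f a = b - p b.
  by have /asboolP [a _ ->] := pI b; exists a.
pose rho b := projT1 (cid (ex b)).
have rhoE b : f (rho b) = b - p b by exact: projT2 (cid (ex b)).
have rhoD x y : rho (x + y) = rho x + rho y.
  by apply: finj; rewrite linearD !rhoE pD opprD addrACA.
have rhoZ a x : rho (kscale a x) = kscale a (rho x).
  by apply: finj; rewrite linearZ /= !rhoE pZ -kscaleN -kscaleD.
have rhof x : rho (f x) = x.
  apply: finj; rewrite rhoE (_ : p (f x) = 0) ?subr0 //.
  by apply/pK; apply/asboolP; exists x.
have rhoG q x : x \in gm_piece q -> rho x \in gm_piece q.
  move=> xq; have -> : rho x = comps (rho x) q; last exact: comps_piece.
  apply: finj; rewrite hom_comps rhoE comps_hom // pieceB //.
  exact: pG.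
pose lam (y : A) : N := val (g y) 1.
have lamD x y : lam (x + y) = lam x + lam y by rewrite /lam linearD.
have lamS s y : lam (s *: y) = val (g y) s.
  by rewrite /lam linearZ /= /shift mul1r.
have lamZ a y : lam (kscale a y) = kscale a (lam y).
  have [_ z] := coind_klin (valP (g y)).
  by rewrite lamS -[X in val _ X]mulr1 z.
have lamG q y : y \in gm_piece q -> lam y \in gm_piece q.
  move=> /(gh_piece g) /asboolP [_ h]; rewrite -[q]addr0; apply: h.
  exact: poly_piece1.
pose h0 (b : B) : S -> N := fun s => lam (rho (s *: b)).
have h0D x y : h0 (x + y) = h0 x + h0 y.
  by apply: funext => s; rewrite /h0 fctE scalerDr rhoD lamD.
have h0G q b : b \in gm_piece q -> coind_piece q (h0 b).
  move=> bq; split; last first.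
    by move=> q' s hs; apply/lamG/rhoG; rewrite addrC; apply: pieceZ.
  split=> [s t|a s]; first by rewrite /h0 scalerDl rhoD lamD.
  by rewrite /h0 -scalerA (rhoZ a) lamZ.
have h0P b : h0 b \in @coind_pred N.
  have [t ht ->] := piece_gen b; elim: t ht => [|y t IH] ht.
    rewrite big_nil; apply: (@coind_pred_piece _ 0); apply: h0G; exact: piece0.
  rewrite big_cons h0D rpredD ?IH //; last first.
    by move=> z hz; apply: ht; rewrite inE hz orbT.
  have [|q hq] := ht y; first by rewrite inE eqxx.
  exact: coind_pred_piece (h0G _ _ hq).
pose h1 (b : B) : coinduced N := Sub (h0 b) (h0P b).
have h1lin : linear h1.
  move=> s x y; apply: val_inj; rewrite /= h0D; congr (_ + _).
  by apply: funext => t; rewrite /shift /h0 scalerA.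
pose h1L := GRing.isLinear.Build _ _ _ _ h1 h1lin.
pose h2 : {linear B -> coinduced N} := HB.pack h1 h1L.
have h2G q x : x \in gm_piece q -> h2 x \in gm_piece q.
  by move=> xq; apply/asboolP; apply: h0G.
exists (GradedHom h2G) => a; apply: val_inj; apply: funext => s /=.
by rewrite /h0 -linearZ rhof lamS.
Qed.

Lemma hom_to_injective N (P : graded_submodule N) :
  exists J : graded_module, gr_injective J /\
  exists e : graded_hom N J, forall x, e x = 0 <-> x \in P.
Proof.
exists (coinduced N); split; first exact: coinduced_injective.
have [p [pD pZ pG pK pI]] := coproj_ex P.
pose h0 (b : N) : S -> N := fun s => p (s *: b).
have h0D x y : h0 (x + y) = h0 x + h0 y.
  by apply: funext => s; rewrite /h0 fctE scalerDr pD.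
have h0G q b : b \in gm_piece q -> coind_piece q (h0 b).
  move=> bq; split; last first.
    by move=> q' s hs; apply: pG; rewrite addrC; apply: pieceZ.
  split=> [s t|a s]; first by rewrite /h0 scalerDl pD.
  by rewrite /h0 -scalerA (pZ a).
have h0P b : h0 b \in @coind_pred N.
  have [t ht ->] := piece_gen b; elim: t ht => [|y t IH] ht.
    rewrite big_nil; apply: (@coind_pred_piece _ 0); apply: h0G; exact: piece0.
  rewrite big_cons h0D rpredD ?IH //; last first.
    by move=> z hz; apply: ht; rewrite inE hz orbT.
  have [|q hq] := ht y; first by rewrite inE eqxx.
  exact: coind_pred_piece (h0G _ _ hq).
pose h1 (b : N) : coinduced N := Sub (h0 b) (h0P b).
have h1lin : linear h1.
  move=> s x y; apply: val_inj; rewrite /= h0D; congr (_ + _).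
  by apply: funext => t; rewrite /shift /h0 scalerA.
pose h1L := GRing.isLinear.Build _ _ _ _ h1 h1lin.
pose h2 : {linear N -> coinduced N} := HB.pack h1 h1L.
have h2G q x : x \in gm_piece q -> h2 x \in gm_piece q.
  by move=> xq; apply/asboolP; apply: h0G.
exists (GradedHom h2G) => x; split=> [/(congr1 (fun z => val z 1))|xP].
  by rewrite /= /h0 scale1r => h; apply/pK.
by apply: val_inj; apply: funext => s; apply/pK; apply: rpredZ.
Qed.

Record ext := Ext { ex_obj : graded_module; ex_sub : graded_submodule ex_obj }.

Definition ext_tgt (x : ext) : graded_module :=
  projT1 (cid (hom_to_injective (ex_sub x))).
Lemma ext_inj x : gr_injective (ext_tgt x).
Proof. by have [] := projT2 (cid (hom_to_injective (ex_sub x))). Qed.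
Lemma ext_hom_ex x : exists e : graded_hom (ex_obj x) (ext_tgt x),
  forall y, e y = 0 <-> y \in ex_sub x.
Proof. by have [] := projT2 (cid (hom_to_injective (ex_sub x))). Qed.
Definition ext_hom x := projT1 (cid (ext_hom_ex x)).
Lemma ext_homP x y : ext_hom x y = 0 <-> y \in ex_sub x.
Proof. by rewrite /ext_hom; case: cid => e /=; apply. Qed.
Definition ext_next x : ext := Ext (image_sub (ext_hom x) (full_sub _)).

Lemma injective_resolution_ex M : inhabited (injective_resolution M).
Proof.
pose E := fix E j := if j is j'.+1 then ext_next (E j') else Ext (zero_sub M).
constructor.
apply: (@InjectiveResolution M (fun j => ext_tgt (E j)) (ext_hom (E 0))
  (fun j => ext_hom (E j.+1))).
- by move=> j; apply: ext_inj.
- move=> x y exy; apply/eqP; rewrite -subr_eq0.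
  by have /ext_homP : ext_hom (E 0) (x - y) = 0 by rewrite linearB exy subrr.
- move=> x; split=> [/ext_homP /asboolP [y _ ->]|[y ->]]; first by exists y.
  by apply/ext_homP/asboolP; exists y.
- move=> j x; split=> [/ext_homP /asboolP [y _ ->]|[y ->]]; first by exists y.
  by apply/ext_homP/asboolP; exists y.
Qed.

Definition resolution M : injective_resolution M :=
  inhabited_witness (injective_resolution_ex M).

(* N_g = 0 *)
Definition piece_zero (N : graded_module) (g : G) : Prop :=
  forall z : N, z \in gm_piece g -> z = 0.

Section Subquotient.
Variables (N : graded_module) (P Q : graded_submodule N).

Definition submod : Type := {x : N | x \in gs_pred P}.
HB.instance Definition _ := SubChoice.on submod.
HB.instance Definition _ := [SubChoice_isSubLmodule of submod by <:].

Definition quot_pred : {pred submod} := fun x => val x \in gs_pred Q.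
Lemma quot_pred_closed : zmod_closed quot_pred.
Proof.
split; first by rewrite /quot_pred unfold_in raddf0 rpred0.
by move=> x y hx hy; rewrite unfold_in /quot_pred raddfB rpredB.
Qed.
HB.instance Definition _ :=
  GRing.isZmodClosed.Build submod quot_pred quot_pred_closed.

(* P / (P :&: Q) *)
Definition subquot : Type := Quotient.quot quot_pred.
HB.instance Definition _ := GRing.Zmodule.on subquot.

Definition quot_pi (x : submod) : subquot := (\pi_(Quotient.quot quot_pred) x)%qT.
Lemma quot_piB x y : quot_pi (x - y) = quot_pi x - quot_pi y.
Proof. exact: raddfB. Qed.
Lemma quot_piD x y : quot_pi (x + y) = quot_pi x + quot_pi y.
Proof. exact: raddfD. Qed.
Lemma quot_pi0 : quot_pi 0 = 0.
Proof. exact: raddf0. Qed.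
Lemma quot_pi_sum (I : Type) (s : seq I) (c : I -> submod) :
  quot_pi (\sum_(i <- s) c i) = \sum_(i <- s) quot_pi (c i).
Proof. by elim/big_rec2: _ => [|i x y _ <-]; rewrite ?quot_pi0 ?quot_piD. Qed.
Lemma quot_pi_eq x y : quot_pi x = quot_pi y <-> val x - val y \in Q.
Proof.
rewrite -raddfB -[X in _ <-> is_true X]/(quot_pred (x - y)).
rewrite -[quot_pred _]/(x - y \in quot_pred) Quotient.idealrBE.
by split=> [h|/eqP]; [apply/eqP|].
Qed.
Lemma quot_pi_eq0 x : quot_pi x = 0 <-> val x \in Q.
Proof.
have := quot_pi_eq x 0; rewrite quot_pi0 (_ : val (0 : submod) = 0) //.
by rewrite subr0.
Qed.
Lemma quot_pi_surj z : exists x, z = quot_pi x.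
Proof. by exists (repr (z : Quotient.quot quot_pred)); rewrite /quot_pi reprK. Qed.

Definition quot_scale (f : S) (z : subquot) : subquot :=
  quot_pi (f *: repr (z : Quotient.quot quot_pred)).
Lemma quot_scale_pi f x : quot_scale f (quot_pi x) = quot_pi (f *: x).
Proof.
apply/quot_pi_eq.
rewrite -[val (f *: repr _)]/(f *: val _) -[val (f *: x)]/(f *: val x).
rewrite -scalerBr; apply: rpredZ; apply/quot_pi_eq.
by rewrite /quot_pi reprK.
Qed.
Lemma quot_scaleA a b v : quot_scale a (quot_scale b v) = quot_scale (a * b) v.
Proof. by have [x ->] := quot_pi_surj v; rewrite !quot_scale_pi scalerA. Qed.
Lemma quot_scale1 : left_id 1 quot_scale.
Proof. by move=> v; have [x ->] := quot_pi_surj v; rewrite quot_scale_pi scale1r. Qed.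
Lemma quot_scaleDr : right_distributive quot_scale +%R.
Proof.
move=> f u v; have [x ->] := quot_pi_surj u; have [y ->] := quot_pi_surj v.
by rewrite -quot_piD !quot_scale_pi scalerDr quot_piD.
Qed.
Lemma quot_scaleDl v : {morph quot_scale^~ v : a b / a + b}.
Proof.
move=> f g; have [x ->] := quot_pi_surj v.
by rewrite !quot_scale_pi scalerDl quot_piD.
Qed.
HB.instance Definition _ := GRing.Zmodule_isLmodule.Build S subquot
  quot_scaleA quot_scale1 quot_scaleDr quot_scaleDl.

Definition subquot_piece (g : G) : {pred subquot} :=
  fun z => `[< exists2 x : submod, val x \in gm_piece g & z = quot_pi x >].

Lemma subquot_grading : is_grading subquot_piece.
Proof.
split.
- move=> g; split; first by apply/asboolP; exists 0; rewrite ?quot_pi0 // piece0.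
  move=> _ _ /asboolP [x hx ->] /asboolP [y hy ->]; apply/asboolP.
  by exists (x - y); rewrite ?quot_piB // raddfB pieceB.
- move=> g h f _ hf /asboolP [x hx ->]; apply/asboolP; exists (f *: x).
    by rewrite linearZ pieceZ.
  exact: quot_scale_pi.
- move=> z; have [x ->] := quot_pi_surj z.
  have [t ht e] := gs_graded (valP x).
  pose F (y : N) : submod := insubd (0 : submod) y.
  exists [seq quot_pi (F y) | y <- t].
    move=> _ /mapP [y /ht [yP [g yg]] ->]; exists g; apply/asboolP; exists (F y) => //.
    by rewrite /F insubdK.
  rewrite big_map -quot_pi_sum; congr quot_pi; apply: val_inj.
  rewrite raddf_sum /= [LHS]e !big_seq; apply: eq_bigr => y /ht [yP _].
  by rewrite /F insubdK.
move=> s c us hc h g gs.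
have ex k : exists x : submod, val x \in gm_piece k /\ c k = quot_pi x.
  by have /asboolP [x ? ?] := hc k; exists x.
pose b k := projT1 (cid (ex k)).
have bG k : val (b k) \in gm_piece k by have [] := projT2 (cid (ex k)).
have bE k : c k = quot_pi (b k) by have [] := projT2 (cid (ex k)).
rewrite bE; apply/quot_pi_eq0.
have hQ : \sum_(k <- s) val (b k) \in Q.
  rewrite -raddf_sum; apply/quot_pi_eq0; rewrite quot_pi_sum -[RHS]h.
  by apply: eq_bigr => k _; rewrite bE.
suff /comps_eq e : comps_spec (\sum_(k <- s) val (b k))
    (fun k => if k \in s then val (b k) else 0).
  by have := sub_comps hQ g; rewrite e gs.
exists s; split=> //.
- by move=> k; case: ifP => // _; apply: piece0.
- by move=> k /negPf ->.
by rewrite !big_seq; apply: eq_bigr => k ->.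
Qed.

Definition subquotient : graded_module := GradedModule subquot_grading.

Lemma subquotient_piece0 g :
  piece_zero subquotient g <->
  (forall x : N, x \in gm_piece g -> x \in P -> x \in Q).
Proof.
split=> h.
  move=> x xg xP; pose y : submod := exist _ x xP.
  apply/(quot_pi_eq0 y); apply: (h (quot_pi y)).
  by apply/asboolP; exists y.
move=> _ /asboolP [x xg ->]; apply/quot_pi_eq0.
by case: x xg => x xP xg; apply: h xg xP.
Qed.
End Subquotient.

Section LocalCohomology.
Variable B : graded_submodule regular.

(* The power B^k: the ideal generated by the products of k elements of B. *)
Definition ideal_pow (k : nat) : {pred S} := fun f =>
  `[< exists2 t : seq (S * seq S),
        (forall p, p \in t -> size p.2 = k /\ {subset p.2 <= gs_pred B})
        & f = \sum_(p <- t) p.1 * \prod_(b <- p.2) b >].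

(* The submodule of the elements killed by some power of B. *)
Definition torsion (N : graded_module) : {pred N} := fun x =>
  `[< exists k, forall f, f \in ideal_pow k -> f *: x = 0 >].

Section Torsion.
Variable N : graded_module.

Definition kills (k : nat) (x : N) : Prop := forall u : seq S,
  size u = k -> {subset u <= gs_pred B} -> (\prod_(b <- u) b) *: x = 0.

Lemma torsionP (x : N) : x \in @torsion N <-> exists k, kills k x.
Proof.
split=> [/asboolP [k h]|[k h]].
  exists k => u uk uB; apply: h; apply/asboolP.
  exists [:: (1, u)]; last by rewrite big_seq1 mul1r.
  by move=> p; rewrite inE => /eqP ->.
apply/asboolP; exists k => _ /asboolP [t ht ->]; elim: t ht => [|p t IH] ht.
  by rewrite big_nil scale0r.
rewrite big_cons scalerDl IH ?addr0; last first.
  by move=> q hq; apply: ht; rewrite inE hq orbT.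
have [|pk pB] := ht p; first by rewrite inE eqxx.
by rewrite -scalerA h // scaler0.
Qed.

Lemma killsS k j x : (k <= j)%N -> kills k x -> kills j x.
Proof.
move=> kj h u uj uB; rewrite -[u](cat_take_drop k) big_cat /= mulrC -scalerA h ?scaler0 //.
  by rewrite size_take uj; case: ltngtP kj.
by move=> b /mem_take; apply: uB.
Qed.

(* It is enough to test on homogeneous elements of B. *)
Lemma kills_hom k x :
  (forall u : seq S, size u = k ->
    (forall b, b \in u -> b \in gs_pred B /\ exists g, b \in poly_piece g) ->
    (\prod_(b <- u) b) *: x = 0) -> kills k x.
Proof.
elim: k x => [|k IH] x h u uk uB; first by apply: h => // b; case: u uk {uB}.
case: u uk uB => // b u [uk] uB.
have /gs_graded [t ht e] : b \in gs_pred B by apply: uB; rewrite inE eqxx.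
rewrite big_cons mulrC -scalerA.
have uB' : {subset u <= gs_pred B} by move=> c hc; apply: uB; rewrite inE hc orbT.
suff -> : b *: x = \sum_(y <- t) (y : S) *: x.
  rewrite scaler_sumr big_seq big1 // => y yt; apply: IH uk uB' => w wk wB.
  suff : (\prod_(c <- (y : S) :: w) c) *: x = 0.
    by rewrite big_cons mulrC -scalerA.
  apply: h => [|c]; first by rewrite /= wk.
  by rewrite inE => /orP [/eqP ->|/wB //]; apply: ht.
rewrite {}e; elim: t {ht} => [|y t IHt]; first by rewrite !big_nil scale0r.
by rewrite !big_cons -IHt -scalerDl.
Qed.

Lemma prod_piece (u : seq S) :
  (forall b, b \in u -> exists g, b \in poly_piece g) ->
  exists g, \prod_(b <- u) b \in poly_piece g.
Proof.
elim: u => [|b u IH] h; first by exists 0; rewrite big_nil poly_piece1.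
have [|g hg] := h b; first by rewrite inE eqxx.
have [|k hk] := IH; first by move=> c hc; apply: h; rewrite inE hc orbT.
exists (g + k); rewrite big_cons.
by case: regular_grading => _ /(_ _ _ _ _ hg hk).
Qed.

Lemma kills_comps k x g : kills k x -> kills k (comps x g).
Proof.
move=> h; apply: kills_hom => u uk uB.
have [|q hq] := @prod_piece u; first by move=> b /uB [].
by rewrite -(compsZ _ _ hq) h ?comps0 // => b /uB [].
Qed.

Lemma torsion_closed : submod_closed (@torsion N).
Proof.
split; first by apply/torsionP; exists 0 => u _ _; rewrite scaler0.
move=> a x y /torsionP [k hx] /torsionP [j hy]; apply/torsionP.
exists (maxn k j) => u uk uB.
rewrite scalerDr scalerA mulrC -scalerA.
rewrite (killsS (leq_maxl k j) hx uk uB) (killsS (leq_maxr k j) hy uk uB).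
by rewrite scaler0 addr0.
Qed.

Lemma torsion_graded x : x \in @torsion N -> exists2 t : seq N,
  (forall y, y \in t -> y \in @torsion N /\ exists g, y \in gm_piece g)
  & x = \sum_(y <- t) y.
Proof.
apply: comps_graded => {}x g /torsionP [k hk]; apply/torsionP; exists k.
exact: kills_comps.
Qed.

(* Gamma_B(N) *)
Definition Gamma : graded_submodule N :=
  GradedSubmodule torsion_closed torsion_graded.
End Torsion.

Section Inter.
Variables (N : graded_module) (P Q : graded_submodule N).
Lemma inter_closed : submod_closed [predI gs_pred P & gs_pred Q].
Proof.
split; first by rewrite inE !rpred0.
by move=> a x y /andP [? ?] /andP [? ?]; rewrite inE !rpredD ?rpredZ.
Qed.
Lemma inter_graded x : x \in [predI gs_pred P & gs_pred Q] -> exists2 t : seq N,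
  (forall y, y \in t -> y \in [predI gs_pred P & gs_pred Q] /\
    exists g, y \in gm_piece g) & x = \sum_(y <- t) y.
Proof.
apply: comps_graded => {}x g /andP [? ?].
by apply/andP; split; apply: sub_comps.
Qed.
Definition inter_sub := GradedSubmodule inter_closed inter_graded.
End Inter.

Section Cohomology.
Variables (M : graded_module) (I : injective_resolution M).

Definition cocycles (i : nat) : graded_submodule (I i) :=
  inter_sub (Gamma (I i)) (ker_sub (ir_d I i)).

Definition coboundaries (i : nat) : graded_submodule (I i) :=
  match i with
  | 0 => zero_sub (I 0)
  | j.+1 => image_sub (ir_d I j) (Gamma (I j))
  end.

End Cohomology.

(* H^i_B(M) = H^i(Gamma_B(I)) for an injective resolution I of M in the category
   of G-graded S-modules, i.e. the i-th right derived functor of Gamma_B with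
   its natural G-grading. *)
Definition local_cohomology (M : graded_module) (i : nat) : graded_module :=
  subquotient (cocycles (resolution M) i) (coboundaries (resolution M) i).

(* Z^i_B(M) *)
Definition vanishing_set (M : graded_module) (i : nat) : set G :=
  [set p | piece_zero (local_cohomology M i) p]%classic.

End LocalCohomology.
End Graded.

Arguments regular {K n r} deg.

Section Regularity.
Context {r : nat}.
Local Notation G := 'rV[int]_r.
Local Open Scope classical_set_scope.

(* The dot product v . d, also written deg_v(d). *)
Definition dotv (v d : G) : int := \sum_(t < r) v 0 t * d 0 t.

Definition coarsening_vector {n : nat} (deg : 'I_n -> G) (v : G) : Prop :=
  forall t : 'I_n, 0 <= dotv v (deg t).

Section Semigroup.
Context {l : nat} (c : 'I_l -> G).

Definition lincomb (w : 'I_l -> nat) : G := \sum_(j < l) c j *+ w j.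

(* The semigroup NC generated by the c_j. *)
Definition NC : set G := range lincomb.

(* NC[j]; for j = 0 only w = 0 occurs, so the value of sign(0) is irrelevant. *)
Definition NCshift (j : int) : set G :=
  \bigcup_(w in [set w : 'I_l -> nat | (\sum_(t < l) w t)%N = `|j|%N])
    [set lincomb w *~ sgz j + h | h in NC].

Lemma NCshift0 : NCshift 0 = NC.
Proof.
apply/seteqP; split=> x.
  by move=> [w _ [h hh <-]]; rewrite sgz0 mulr0z add0r.
move=> hx; exists (fun=> 0%N); first by rewrite /= big1.
by exists x => //; rewrite sgz0 mulr0z add0r.
Qed.

End Semigroup.

(* reg_{B,C}(M) *)
Definition regularity {K : fieldType} {n l : nat} {deg : 'I_n -> G}
    (B : graded_submodule (regular (K := K) deg)) (c : 'I_l -> G)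
    (M : graded_module (K := K) deg) : set G :=
  [set m | forall i : nat,
    [set m + q | q in NCshift c (1 - i%:Z)] `<=` vanishing_set B M i].

(* m(k,i). The maximum and minimum are over the nonempty family c; seeding them
   with its first member does not change them. *)
Definition mki {l : nat} (v : G) (c : 'I_l.+1 -> G) (k : int) (i : nat) : int :=
  if k - i%:Z < 0
  then \big[Order.max/dotv v (c ord0)]_(j < l.+1) dotv v (c j)
  else \big[Order.min/dotv v (c ord0)]_(j < l.+1) dotv v (c j).

End Regularity.

(* Main.v *)
(** Pairing with [v] turns membership in [NC[j]] into a numerical bound: an
    element [sgn(j) sum_t w_t c_t + h] with [sum_t w_t = |j|] and [h] in [NC]
    has [v]-degree at least [j] times the minimum (if [j >= 0]) or the maximum
    (if [j < 0]) of the [v . c_t], since [v . h >= 0].  So every translate by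
    [m] lies in the half-space where the cohomology is assumed to vanish. *)

Require Import Defs.
From HB Require Import structures.
From mathcomp Require Import all_boot all_order all_algebra.
From mathcomp Require Import mpoly.
From mathcomp Require Import boolp classical_sets.

Set Implicit Arguments.
Unset Strict Implicit.
Unset Printing Implicit Defensive.

Import Order.TTheory GRing.Theory Num.Theory.

Local Open Scope ring_scope.
Local Open Scope classical_set_scope.

Lemma dotvD r (v x y : 'rV[int]_r) : dotv v (x + y) = dotv v x + dotv v y.
Proof.
by rewrite /dotv -big_split; apply: eq_bigr => t _; rewrite mxE mulrDr.
Qed.

Lemma dotv0 r (v : 'rV[int]_r) : dotv v 0 = 0.
Proof. by rewrite /dotv big1 // => t _; rewrite mxE mulr0. Qed.

Lemma dotvN r (v x : 'rV[int]_r) : dotv v (- x) = - dotv v x.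
Proof. by apply/eqP; rewrite -addr_eq0 -dotvD addNr dotv0. Qed.

Lemma dotvMn r (v x : 'rV[int]_r) a : dotv v (x *+ a) = dotv v x *+ a.
Proof.
by elim: a => [|a IH]; rewrite ?mulr0n ?dotv0 // !mulrS dotvD IH.
Qed.

Lemma dotv_lincomb r l (c : 'I_l -> 'rV[int]_r) v w :
  dotv v (lincomb c w) = \sum_(j < l) dotv v (c j) *+ w j.
Proof.
rewrite (big_morph (dotv v) (dotvD v) (dotv0 v)).
by apply: eq_bigr => j _; rewrite dotvMn.
Qed.

Lemma dotv_NCshift_ge r l (c : 'I_l.+1 -> 'rV[int]_r) v (k : int) i q :
  (forall j, 0 <= dotv v (c j)) -> NCshift c (k - i%:Z) q ->
  (k - i%:Z) * mki v c k i <= dotv v q.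
Proof.
(* [w] holds the weights of total [|k - i|], [u] the coefficients of the added element of [NC]. *)
move=> hc [w /= hw [_ [u _ <-] <-]]; rewrite /mki.
have hu : 0 <= dotv v (lincomb c u).
  by rewrite dotv_lincomb sumr_ge0 // => j _; rewrite mulrn_wge0.
rewrite dotvD -[leLHS]addr0; apply: lerD hu.
(* The sign of [k - i] also decides between maximum and minimum in [mki]. *)
case: (ltgtP (k - i%:Z) 0) hw => [j0|j0|->] hw; last first.
- by rewrite mul0r sgz0 mulr0z dotv0.
(* Writing [k - i] as the sum of the [w j] spreads the minimum over the summands, so the bound can
   be checked term by term. *)
- rewrite gtr0_sgz // mulr1z dotv_lincomb -[in leLHS](gtz0_abs j0) -hw.
  rewrite mulrC -natz mulr_natr -sumrMnr.
  by apply: ler_sum => j _; rewrite lerMn2r bigmin_le orbT.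
(* Here [k - i] is minus the sum of the [w j]; cancelling the signs reverses the inequality, hence
   the maximum. *)
- rewrite ltr0_sgz // mulrN1z dotvN dotv_lincomb.
  rewrite -[k - _]opprK -(ltz0_abs j0) -hw mulNr lerN2.
  rewrite mulrC -natz mulr_natr -sumrMnr.
  by apply: ler_sum => j _; rewrite lerMn2r le_bigmax orbT.
Qed.

Theorem theorem4p11 (K : fieldType) (n r l : nat)
    (deg : 'I_n -> 'rV[int]_r)
    (c : 'I_l.+1 -> 'rV[int]_r)
    (v : 'rV[int]_r) (hv : coarsening_vector deg v)
    (hc : forall j, 0 <= dotv v (c j))
    (k : int) (M : graded_module (K := K) deg) (m : 'rV[int]_r)
    (B : graded_submodule (regular (K := K) deg)) :
  (forall i : nat,
     (forall d : 'rV[int]_r,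
        dotv v d >= dotv v m + (k - i%:Z) * mki v c k i ->
        piece_zero (local_cohomology B M i) d) ->
     [set m + q | q in NCshift c (k - i%:Z)] `<=` vanishing_set B M i)
  /\
  (k = 1 ->
   (forall (i : nat) (d : 'rV[int]_r),
      dotv v d >= dotv v m + (k - i%:Z) * mki v c k i ->
      piece_zero (local_cohomology B M i) d) ->
   regularity B c M m).
Proof.
have main i : (forall d, dotv v d >= dotv v m + (k - i%:Z) * mki v c k i ->
    piece_zero (local_cohomology B M i) d) ->
    [set m + q | q in NCshift c (k - i%:Z)] `<=` vanishing_set B M i.
  (* Cancelling [dotv v m] leaves exactly the bound on [q]. *)
  by move=> h _ [q hq <-]; apply: h; rewrite dotvD lerD2l dotv_NCshift_ge.
(* [regularity] unfolds to these inclusions for all [i], with [1] for [k]. *)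
split=> [//|k1 h i]; rewrite -k1; exact: main (h i).
Qed.
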